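(* Let $y=\sum_{i=0}^\infty c_i\phi_i$ and $z=\sum_{i=0}^\infty d_i\phi_i$ be two formal series, where $\{\phi_i\}_{i\ge0}$ is an orthogonal polynomial basis. Let $n\in\mathbb{N}$ and suppose that $d_i=\rho\,c_i$ for $i=0,1,\dots,n$, with a constant $\rho$ such that $0<|\rho|<\infty$. Let $p,q\in\mathbb{N}$ be such that $p+2q\le n$ and suppose that $\mathbf{H}_y^{[p/q]}$ is regular (nonsingular). Then: (a) $\mathbf{H}_z^{[p/q]}=\rho\,\mathbf{H}_y^{[p/q]}$, $\mathbf{G}_z^{[p/q]}=\rho\,\mathbf{G}_y^{[p/q]}$, $\mathbf{h}_z^{[p/q]}=\rho\,\mathbf{h}_y^{[p/q]}$ and $\mathbf{g}_z^{[p/q]}=\rho\,\mathbf{g}_y^{[p/q]}$; (b) $\mathbf{H}_z^{[p/q]}$ is regular; (c) $N_{p,q}(z)=\rho\,N_{p,q}(y)$ and $D_{p,q}(z)=D_{p,q}(y)$; (d) $\Phi_{p,q}(z)=\rho\,\Phi_{p,q}(y)$.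
   Context: $\{\phi_i\}_{i\ge0}$ is a family of real polynomials, $\deg\phi_i=i$, orthogonal on an interval $I\subset\mathbb{R}$ with respect to a weight $w$, satisfying $t\phi_i=\alpha_i\phi_{i+1}+\beta_i\phi_i+\gamma_i\phi_{i-1}$ for $i\ge1$, $\phi_0=1$, $\phi_1=(t-\beta_0)/\alpha_0$. For a formal series $y=\sum_k c_k\phi_k$ (real coefficients), define $h_{j,i}$ by the formal product $\phi_iy=\sum_{j\ge0}h_{j,i}\phi_j$, obtained by re-expanding each $\phi_i\phi_k$ in the basis (it involves only $\phi_j$ with $|i-k|\le j\le i+k$, so each $h_{j,i}$ is a finite sum). For $p\ge0$, $q\ge1$ set $$\mathbf{g}_y^{[p/q]}=[h_{0,q},\dots,h_{p,q}]^T,\quad \mathbf{h}_y^{[p/q]}=[h_{p+1,q},\dots,h_{p+q,q}]^T,$$ $$\mathbf{G}_y^{[p/q]}=[h_{j,i}]_{0\le j\le p,\;0\le i\le q-1},\quad \mathbf{H}_y^{[p/q]}=[h_{j,i}]_{p+1\le j\le p+q,\;0\le i\le q-1},$$ with $j$ the row index and $i$ the column index. When $\mathbf{H}_y^{[p/q]}$ is nonsingular, the normalized Frobenius-Padé approximant of type $(p,q)$ is $\Phi_{p,q}(y)=N_{p,q}(y)/D_{p,q}(y)$, with $N_{p,q}(y)=\sum_{i=0}^pa_i\phi_i$, $D_{p,q}(y)=\phi_q+\sum_{i=0}^{q-1}b_i\phi_i$, where $\mathbf{b}=[b_0,\dots,b_{q-1}]^T$ and $\mathbf{a}=[a_0,\dots,a_p]^T$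 are given by $\mathbf{H}_y^{[p/q]}\mathbf{b}=-\mathbf{h}_y^{[p/q]}$ and $\mathbf{a}=\mathbf{G}_y^{[p/q]}\mathbf{b}+\mathbf{g}_y^{[p/q]}$. The same notation with subscript or argument $z$ refers to the series $z$. *)

(* Defs.v *)
From HB Require Import structures.
From mathcomp Require Import all_boot all_order all_algebra.
From mathcomp Require Import all_classical all_reals all_analysis.
Set Implicit Arguments.
Unset Strict Implicit.
Unset Printing Implicit Defensive.
Import Order.TTheory GRing.Theory Num.Theory.
Local Open Scope classical_set_scope.
Local Open Scope ring_scope.

(* [w] may vanish on part of [I], but the last field excludes a.e. vanishing,
   hence also intervals without interior points. *)
Record weight_on (R : realType) (I : interval R) (w : R -> R) : Prop := {
  weight_ge0 : forall t, t \in I -> 0 <= w t;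
  weight_moments : forall k : nat,
    lebesgue_measure.-integrable [set` I] (fun t => (t ^+ k * w t)%:E);
  weight_mass_gt0 :
    (0 < \int[lebesgue_measure]_(t in [set` I]) (w t)%:E)%E }.

(* [size] is one plus the degree; with [basis_1] and [basis_recurrence],
   [basis_size] forces [alpha i != 0] for every [i]. *)
Record orthogonal_basis (R : realType) (I : interval R) (w : R -> R)
    (phi : nat -> {poly R}) (alpha beta gamma : nat -> R) : Prop := {
  basis_size : forall i, size (phi i) = i.+1;
  basis_orthogonal : forall i j, i != j ->
    (\int[lebesgue_measure]_(t in [set` I])
      ((phi i).[t] * (phi j).[t] * w t)%:E = 0)%E;
  basis_0 : phi 0%N = 1;
  basis_1 : phi 1%N = (alpha 0%N)^-1 *: ('X - (beta 0%N)%:P);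
  basis_recurrence : forall i, (1 <= i)%N ->
    'X * phi i =
      alpha i *: phi i.+1 + beta i *: phi i + gamma i *: phi i.-1 }.

Definition is_expansion (R : realType) (phi : nat -> {poly R}) (f : {poly R})
    (a : nat -> R) : Prop :=
  (forall j, (size f <= j)%N -> a j = 0) /\
  f = \sum_(j < size f) a j *: phi j.

Definition basis_coord (R : realType) (phi : nat -> {poly R})
    (f : {poly R}) : nat -> R :=
  xget (fun _ => 0) [set a | is_expansion phi f a].

Lemma basis_lead (R : realType) (phi : nat -> {poly R}) (n : nat) :
  size (phi n) = n.+1 -> (phi n)`_n != 0.
Proof.
move=> sn; have -> : n = (size (phi n)).-1 :> nat by rewrite sn.
by rewrite sn /= -[X in _`_X]/(n.+1.-1) -sn -lead_coefE lead_coef_eq0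
           -size_poly_eq0 sn.
Qed.

Lemma basis_free (R : realType) (phi : nat -> {poly R}) (n : nat)
    (a : nat -> R) :
  (forall i, size (phi i) = i.+1) ->
  \sum_(j < n) a j *: phi j = 0 -> forall j, (j < n)%N -> a j = 0.
Proof.
move=> sphi; elim: n => [//|n IH]; rewrite big_ord_recr /= => s0.
have an0 : a n = 0.
  move/(congr1 (fun f : {poly R} => f`_n)): s0.
  rewrite coef0 coefD coefZ coef_sum big1 ?add0r.
    by move/eqP; rewrite mulf_eq0 (negbTE (basis_lead (sphi n))) orbF => /eqP.
  move=> j _; rewrite coefZ nth_default ?mulr0 // sphi; exact: ltn_ord.
move: s0; rewrite an0 scale0r addr0 => /IH{}IH j.
by rewrite ltnS leq_eqVlt => /orP[/eqP->|/IH].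
Qed.

Lemma expansion_exists (R : realType) (phi : nat -> {poly R}) (f : {poly R}) :
  (forall i, size (phi i) = i.+1) -> exists a, is_expansion phi f a.
Proof.
move=> sphi.
suff /(_ _ _ (leqnn (size f)))[a aP] : forall n (g : {poly R}),
    (size g <= n)%N -> exists a : nat -> R, g = \sum_(j < n) a j *: phi j.
  exists (fun j => if (j < size f)%N then a j else 0); split.
    by move=> j; rewrite leqNgt => /negbTE->.
  by rewrite [LHS]aP; apply: eq_bigr => j _; rewrite ltn_ord.
move=> n; elim: n {f} => [|n IH] f.
  by rewrite leqn0 size_poly_eq0 => /eqP->; exists (fun=> 0); rewrite big_ord0.
move=> sf; pose c := f`_n / (phi n)`_n.
have phin0 := basis_lead (sphi n).
have [|a aP] := IH (f - c *: phi n).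
  apply/leq_sizeP => j; rewrite leq_eqVlt => /orP[/eqP<-|nj].
    by rewrite coefB coefZ /c divfK // subrr.
  rewrite coefB coefZ !nth_default ?mulr0 ?subrr ?sphi //.
  exact: leq_trans sf _.
exists (fun j => if j == n then c else a j).
rewrite big_ord_recr /= eqxx -[LHS](subrK (c *: phi n)) aP; congr (_ + _).
by apply: eq_bigr => j _; rewrite ltn_eqF.
Qed.

Lemma expansion_unique (R : realType) (phi : nat -> {poly R}) (f : {poly R})
    (a b : nat -> R) :
  (forall i, size (phi i) = i.+1) ->
  is_expansion phi f a -> is_expansion phi f b -> a =1 b.
Proof.
move=> sphi [a0 fa] [b0 fb] j; have [jf|fj] := ltnP j (size f); last first.
  by rewrite a0 ?b0.
apply/eqP; rewrite -subr_eq0; apply/eqP.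
apply: (basis_free (a := fun i => a i - b i) sphi _ jf).
under eq_bigr do rewrite scalerBl.
by rewrite sumrB -fa -fb subrr.
Qed.

Lemma basis_coordP (R : realType) (phi : nat -> {poly R}) (f : {poly R}) :
  (forall i, size (phi i) = i.+1) ->
  is_expansion phi f (basis_coord phi f).
Proof. by move=> sphi; apply: xgetPex; exact: expansion_exists. Qed.

(* A formal series [\sum_k c_k phi_k] is represented by its coefficient
   sequence [c : nat -> R].  [prod_coef phi c j i] is h_{j,i}, the coefficient
   of [phi j] in the formal product of [phi i] with the series; the sum over
   all k has finite support for an orthogonal basis. *)
Definition prod_coef (R : realType) (phi : nat -> {poly R}) (c : nat -> R)
    (j i : nat) : R :=
  \sum_(k \in [set: nat]) c k * basis_coord phi (phi i * phi k) j.

Section FrobeniusPade.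
Variables (R : realType) (phi : nat -> {poly R}) (c : nat -> R) (p q : nat).

Definition FP_g : 'cV[R]_p.+1 := \col_(j < p.+1) prod_coef phi c j q.
Definition FP_h : 'cV[R]_q := \col_(j < q) prod_coef phi c (p.+1 + j) q.
Definition FP_G : 'M[R]_(p.+1, q) :=
  \matrix_(j < p.+1, i < q) prod_coef phi c j i.
Definition FP_H : 'M[R]_q :=
  \matrix_(j < q, i < q) prod_coef phi c (p.+1 + j) i.

(* The solution of [FP_H *m b = - FP_h]; see [FP_bP]. *)
Definition FP_b : 'cV[R]_q := invmx FP_H *m - FP_h.
Definition FP_a : 'cV[R]_p.+1 := FP_G *m FP_b + FP_g.

Lemma FP_bP (b : 'cV[R]_q) :
  FP_H \in unitmx -> (FP_H *m b = - FP_h <-> b = FP_b).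
Proof.
move=> uH; split=> [e|->]; last by rewrite mulKVmx.
by rewrite /FP_b -e mulKmx.
Qed.

Definition FP_num : {poly R} := \sum_(i < p.+1) FP_a i 0 *: phi i.
Definition FP_den : {poly R} := phi q + \sum_(i < q) FP_b i 0 *: phi i.

Definition FP_approx : {fraction {poly R}} := tofrac FP_num / tofrac FP_den.

End FrobeniusPade.

(* Main.v *)
Require Import Defs.
From HB Require Import structures.
From mathcomp Require Import all_boot all_order all_algebra.
From mathcomp Require Import all_classical all_reals all_analysis.
From mathcomp Require Import zify.
Import Order.TTheory GRing.Theory Num.Theory.
Local Open Scope ring_scope.

(* The three-term recurrence shows that multiplication by ['X] lowers the least
   index occurring in an expansion by at most one.  Hence [phi j] does not occur
   in [phi i * phi k] as soon as [i + j < k], and h_{j,i} only depends on the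
   coefficients of index at most [i + j], linearly.  All entries used by the
   approximant of type (p, q) have [i + j <= p + 2q]. *)

Section BasisCoord.
Context {R : realType} (phi : nat -> {poly R}).
Hypothesis size_phi : forall i, size (phi i) = i.+1.

(** Allowing any [N] above the size, with zero padding, lets several polynomials be expanded over
    one common range. *)
Lemma basis_coord_expand {f : {poly R}} {N : nat} :
  (size f <= N)%N -> f = \sum_(j < N) basis_coord phi f j *: phi j.
Proof.
move=> fN; have [f0 fE] := basis_coordP f size_phi.
rewrite {1}fE (big_ord_widen N (fun j => basis_coord phi f j *: phi j) fN).
rewrite big_mkcond; apply: eq_bigr => j _.
by case: ltnP => // /f0 ->; rewrite scale0r.
Qed.

(** As [basis_coord] is obtained by choice, its values can only be identified through the linear
    independence of the [phi i]. *)
Lemma basis_coord_sum (N : nat) (a : nat -> R) (j : nat) :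
  basis_coord phi (\sum_(i < N) a i *: phi i) j = if (j < N)%N then a j else 0.
Proof.
set f := \sum_(i < N) _.
have fN : (size f <= N)%N.
  by apply: leq_trans (size_sum _ _ _) _; apply/bigmax_leqP => i _;
     apply: leq_trans (size_scale_leq _ _) _; rewrite size_phi.
case: ltnP => [jN|Nj]; last first.
  by have [-> //] := basis_coordP f size_phi; exact: leq_trans Nj.
apply/eqP; rewrite -subr_eq0; apply/eqP.
apply: (Defs.basis_free (a := fun i => basis_coord phi f i - a i) size_phi _ jN).
under eq_bigr do rewrite scalerBl.
by rewrite sumrB -basis_coord_expand// subrr.
Qed.

Lemma basis_coordZD (a : R) (f g : {poly R}) (j : nat) :
  basis_coord phi (a *: f + g) j = a * basis_coord phi f j + basis_coord phi g j.
Proof.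
(* Including [j.+1] keeps [j] inside the range, away from the default value 0 of
   [basis_coord_sum]. *)
pose N := maxn j.+1 (maxn (size f) (size g)).
have fN : (size f <= N)%N by rewrite /N !leq_max leqnn !orbT.
have gN : (size g <= N)%N by rewrite /N !leq_max leqnn !orbT.
have -> : a *: f + g = \sum_(i < N)
    (a * basis_coord phi f i + basis_coord phi g i) *: phi i.
  rewrite {1}(basis_coord_expand fN) {1}(basis_coord_expand gN).
  rewrite scaler_sumr -big_split; apply: eq_bigr => i _ /=.
  by rewrite scalerDl scalerA.
rewrite (basis_coord_sum N
  (fun i => a * basis_coord phi f i + basis_coord phi g i)).
by rewrite /N leq_max leqnn.
Qed.

Lemma basis_coord0 (j : nat) : basis_coord phi 0 j = 0.
Proof. by have := basis_coord_sum 0 (fun=> 0) j; rewrite big_ord0. Qed.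

Lemma basis_coord_lincomb (N : nat) (a : nat -> R) (f : nat -> {poly R})
    (j : nat) :
  basis_coord phi (\sum_(i < N) a i *: f i) j =
  \sum_(i < N) a i * basis_coord phi (f i) j.
Proof.
apply: (big_rec2 (fun g x => basis_coord phi g j = x)) => [|i x g _ <-].
  exact: basis_coord0.
exact: basis_coordZD.
Qed.

Lemma basis_coord_id (k j : nat) : basis_coord phi (phi k) j = (j == k)%:R.
Proof.
have -> : phi k = \sum_(i < k.+1) (val i == k)%:R *: phi i.
  rewrite big_ord_recr /= eqxx scale1r big1 ?add0r// => i _.
  by rewrite ltn_eqF ?scale0r.
rewrite (basis_coord_sum k.+1 (fun i => (i == k)%:R)) ltnS.
by case: leqP => // kj; rewrite gtn_eqF.
Qed.

Context {alpha beta gamma : nat -> R}.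
Hypothesis phi_recurrence : forall i, (1 <= i)%N ->
  'X * phi i = alpha i *: phi i.+1 + beta i *: phi i + gamma i *: phi i.-1.

Lemma basis_coord_mulX_eq0 {f : {poly R}} {m : nat} :
  (forall j, (j < m.+1)%N -> basis_coord phi f j = 0) ->
  forall j, (j < m)%N -> basis_coord phi ('X * f) j = 0.
Proof.
move=> f0 j jm.
rewrite (basis_coord_expand (leqnn (size f))) mulr_sumr.
under eq_bigr do rewrite -scalerAr.
rewrite (basis_coord_lincomb _ _ (fun k => 'X * phi k)) big1// => k _.
have [km|mk] := ltnP k m.+1; first by rewrite f0 ?mul0r.
(* From [m < k] one gets [1 <= k], so the recurrence applies; the indices [k.-1], [k], [k.+1] it
   produces are all at least [m], hence differ from [j]. *)
rewrite phi_recurrence; last exact: leq_trans mk.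
rewrite -addrA !basis_coordZD -[gamma k *: _]addr0 basis_coordZD.
rewrite basis_coord0 !basis_coord_id.
have -> : (j == k.+1) = false by lia.
have -> : (j == k :> nat) = false by lia.
have -> : (j == k.-1) = false by lia.
by rewrite !mulr0 !addr0 mulr0.
Qed.

Lemma basis_coord_mul_eq0 (i j k : nat) :
  (i + j < k)%N -> basis_coord phi (phi i * phi k) j = 0.
Proof.
move=> ijk.
have XP m : forall l, (l < k - m)%N -> basis_coord phi ('X^m * phi k) l = 0.
  elim: m => [|m IH] l lk.
    by rewrite expr0 mul1r basis_coord_id ltn_eqF// -(subn0 k).
  (* Each factor ['X] costs one index. By [l < k - m.+1] the subtraction is not truncated, so
     [(k - m.+1).+1] equals [k - m], the range of [IH]. *)
  rewrite exprS -mulrA; apply: (basis_coord_mulX_eq0 (m := k - m.+1)) => // s sk.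
  by apply: IH; lia.
rewrite -[phi i]coefK poly_def mulr_suml.
under eq_bigr do rewrite -scalerAl.
rewrite (basis_coord_lincomb _ _ (fun m => 'X^m * phi k)) big1// => m _.
(* Only monomials with [m <= i] occur in [phi i], and then [j < k - i <= k - m]. *)
by rewrite XP ?mulr0//; have := ltn_ord m; rewrite {2}size_phi; lia.
Qed.

Lemma prod_coef_scale {c d : nat -> R} {rho : R} {n : nat} :
  (forall k, (k <= n)%N -> d k = rho * c k) ->
  forall i j, (i + j <= n)%N -> prod_coef phi d j i = rho * prod_coef phi c j i.
Proof.
move=> dc i j ijn; rewrite /prod_coef mulr_fsumr; apply: eq_fsbigr => k _.
have [kn|nk] := leqP k n; first by rewrite dc// mulrA.
(* Beyond [n] nothing relates [d k] to [c k], but both are multiplied by a zero coordinate, since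
   [i + j <= n < k]. *)
by rewrite basis_coord_mul_eq0 ?mulr0//; exact: leq_ltn_trans nk.
Qed.

End BasisCoord.

Theorem corollary5 (R : realType) (I : interval R) (w : R -> R)
    (phi : nat -> {poly R}) (alpha beta gamma : nat -> R)
    (Hw : weight_on I w)
    (Hphi : orthogonal_basis I w phi alpha beta gamma)
    (c d : nat -> R) (n : nat) (rho : R) (Hrho : 0 < `|rho|)
    (Hd : forall i, (i <= n)%N -> d i = rho * c i)
    (p q : nat) (Hq : (1 <= q)%N) (Hpq : (p + 2 * q <= n)%N)
    (HH : FP_H phi c p q \in unitmx) :
  [/\ (* a *)
      [/\ FP_H phi d p q = rho *: FP_H phi c p q,
          FP_G phi d p q = rho *: FP_G phi c p q,
          FP_h phi d p q = rho *: FP_h phi c p q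
        & FP_g phi d p q = rho *: FP_g phi c p q],
      (* b *)
      FP_H phi d p q \in unitmx,
      (* c *)
      FP_num phi d p q = rho *: FP_num phi c p q
        /\ FP_den phi d p q = FP_den phi c p q
    & (* d *)
      FP_approx phi d p q = tofrac rho%:P * FP_approx phi c p q].
Proof.
have rho0 : rho != 0 by rewrite -normr_gt0.
have scale := prod_coef_scale phi (basis_size Hphi) (basis_recurrence Hphi) Hd.
have HE : FP_H phi d p q = rho *: FP_H phi c p q.
  by apply/matrixP => j i; rewrite !mxE scale//; move: (ltn_ord j) (ltn_ord i); lia.
have GE : FP_G phi d p q = rho *: FP_G phi c p q.
  by apply/matrixP => j i; rewrite !mxE scale//; move: (ltn_ord j) (ltn_ord i); lia.
have hE : FP_h phi d p q = rho *: FP_h phi c p q.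
  (* This is the tight case: the last entry is h_{p+q,q}, whose index sum is exactly p + 2q. *)
  by apply/matrixP => j i; rewrite !mxE scale//; move: (ltn_ord j); lia.
have gE : FP_g phi d p q = rho *: FP_g phi c p q.
  by apply/matrixP => j i; rewrite !mxE scale//; move: (ltn_ord j); lia.
have HHd : FP_H phi d p q \in unitmx by rewrite HE unitmxZ ?unitfE.
have bE : FP_b phi d p q = FP_b phi c p q.
  (* Both sides of the linear system are multiplied by [rho], so the solution for [c] also solves
     the system for [d]; regularity makes it the only one. *)
  apply/esym/(FP_bP _ HHd); rewrite HE hE -scalemxAl -scalerN; congr (_ *: _).
  exact/(FP_bP _ HH).
have aE : FP_a phi d p q = rho *: FP_a phi c p q.
  by rewrite /FP_a bE GE gE -scalemxAl scalerDr.
have NE : FP_num phi d p q = rho *: FP_num phi c p q.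
  rewrite /FP_num aE scaler_sumr; apply: eq_bigr => i _.
  by rewrite mxE scalerA.
have DE : FP_den phi d p q = FP_den phi c p q by rewrite /FP_den bE.
split=> //.
by rewrite /FP_approx NE DE -mul_polyC rmorphM mulrA.
Qed.
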